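(* Every strongly $J^{\#}$-clean ring is Dedekind-finite.
   Context: All rings are associative with identity, not necessarily commutative. $J(R)$ denotes the Jacobson radical of $R$ and $J^{\#}(R)=\{z\in R : z^n\in J(R)\text{ for some } n\ge 1\}$. A ring $R$ is strongly $J^{\#}$-clean if every $a\in R$ can be written $a=e+j$ with $e^2=e\in R$, $j\in J^{\#}(R)$ and $ej=je$. A ring $R$ is Dedekind-finite if $ab=1$ implies $ba=1$ for all $a,b\in R$. *)

(* Defs.v *)
From HB Require Import structures.
From mathcomp Require Import all_boot all_algebra.
From mathcomp Require Import boolp classical_sets.

Set Implicit Arguments.
Unset Strict Implicit.
Unset Printing Implicit Defensive.

Import GRing.Theory.

Local Open Scope classical_set_scope.
Local Open Scope ring_scope.

(* Rings are [pzRingType]s (associative, unital, not necessarily commutative),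
   so the zero ring is included. *)

(* A left ideal is a submodule of the left regular module [R^o]. *)
Definition left_ideal (R : pzRingType) (I : set R^o) : Prop :=
  GRing.submod_closed (mem I).

Definition maximal_left_ideal (R : pzRingType) (M : set R) : Prop :=
  [/\ left_ideal M, M <> setT
    & forall I : set R, left_ideal I -> M `<=` I -> I = M \/ I = setT].

(* In the zero ring there is no maximal left ideal and the radical is [setT]. *)
Definition jacobson_radical (R : pzRingType) : set R :=
  \bigcap_(M in [set M | @maximal_left_ideal R M]) M.
Arguments jacobson_radical : clear implicits.

Definition jsharp (R : pzRingType) : set R :=
  [set z : R | exists2 n : nat, (1 <= n)%N & jacobson_radical R (z ^+ n)].
Arguments jsharp : clear implicits.

Definition strongly_jsharp_clean (R : pzRingType) : Prop :=
  forall a : R, exists e j : R,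
    [/\ a = e + j, e ^+ 2 = e, jsharp R j & e * j = j * e].

Definition dedekind_finite (R : pzRingType) : Prop :=
  forall a b : R, a * b = 1 -> b * a = 1.

(* Main.v *)
Require Import Defs.
From mathcomp Require Import all_boot all_algebra.
From mathcomp Require Import boolp classical_sets.

(** Everything rests on one property of the radical, [jacobson_fixed_eq0]: left
    multiplication by [x] in [J(R)] fixes no nonzero element, because the left
    annihilator of a fixed [h <> 0] would be a proper left ideal containing
    [1 - x], hence would lie in a maximal left ideal containing both [x] and
    [1 - x].

    Let [a * b = 1] and [a = e + j] with [e] idempotent, [e * j = j * e] and
    [j ^+ n] in [J(R)]; put [f = 1 - e].

    Multiplying by [f] turns [a] into [j], so [f * a ^+ n = f * j ^+ n], and
    [x = b ^+ n * f * j ^+ n = b ^+ n * f * a ^+ n] is in [J(R)].  As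
    [a ^+ n * b ^+ n = 1], this [x] fixes [b ^+ n * f], which is therefore zero,
    and multiplying by [a ^+ n] gives [f = 0], that is, [a = 1 + j].

    Now [h = 1 - b * a] satisfies [a * h = 0], so [- j] fixes [h]; then so does
    [(- j) ^+ n], an element of [J(R)], and [h = 0]. *)

Set Implicit Arguments.
Unset Strict Implicit.
Unset Printing Implicit Defensive.

Import GRing.Theory.

Local Open Scope classical_set_scope.
Local Open Scope ring_scope.

Lemma left_idealP (R : pzRingType) (I : set R) :
  @left_ideal R I <->
  I 0 /\ forall a u v : R, I u -> I v -> I (a * u + v).
Proof.
split=> [[I0 IS]|[I0 IS]].
  split=> [|a u v Iu Iv]; first exact: (set_mem I0).
  exact/set_mem/(IS a u v (mem_set Iu) (mem_set Iv)).
split=> [|a u v Iu Iv]; first exact: (mem_set I0).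
exact/mem_set/(IS a u v (set_mem Iu) (set_mem Iv)).
Qed.

Lemma left_ideal_mull (R : pzRingType) (I : set R) (a u : R) :
  @left_ideal R I -> I u -> I (a * u).
Proof. by move=> /left_idealP[I0 IS] Iu; rewrite -[a * u]addr0; apply: IS. Qed.

Lemma left_ideal_eqT (R : pzRingType) (I : set R) :
  @left_ideal R I -> I 1 -> I = setT.
Proof.
move=> idI I1; apply/seteqP; split=> // r _.
by rewrite -[r]mulr1; apply: left_ideal_mull.
Qed.

(** Zorn's lemma: properness means not containing [1], which passes to unions
    of chains. *)
Lemma exists_maximal_left_ideal (R : pzRingType) (L : set R) :
  @left_ideal R L -> ~ L 1 -> exists2 M, @maximal_left_ideal R M & L `<=` M.
Proof.
move=> idL L1.
(* Imposing the condition on [L `|` A] instead of [A] makes the union of the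
   empty chain admissible. *)
pose P : set (set R) := [set A | @left_ideal R (L `|` A) /\ ~ (L `|` A) 1].
have [|A [[idA A1] maxA]] := @Zorn_bigcup R P.
  move=> F FP Ftot; split; last first.
    by case=> // -[A FA A1]; case: (FP _ FA) => _; apply; right.
  have [L0 LS] := (left_idealP L).1 idL.
  apply/left_idealP; split=> [|a u v]; first by left.
  have common A u' v' : F A -> (L `|` A) u' -> (L `|` A) v' ->
      (L `|` \bigcup_(X in F) X) (a * u' + v').
    move=> FA Au Av; have [/left_idealP[_ AS] _] := FP _ FA.
    by case: (AS a _ _ Au Av) => [Lr|Ar]; [left | right; exists A].
  move=> [Lu|[A FA Au]] [Lv|[B FB Bv]].
  - by left; apply: LS.
  - by apply: (common B) => //; [left | right].
  - by apply: (common A) => //; [right | left].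
  - case: (Ftot A B FA FB) => [AB|BA].
      by apply: (common B) => //; right=> //; apply: AB.
    by apply: (common A) => //; right=> //; apply: BA.
exists (L `|` A); last by move=> r; left.
split=> // [AT|I idI AI]; first by apply: A1; rewrite AT.
have [I1|I1] := pselect (I 1); first by right; apply: left_ideal_eqT.
left; apply/seteqP; split=> //.
apply: contrapT => IA; apply: (maxA I).
  by split=> [r Ar|IA']; [apply: AI; right | apply: IA => r /IA'; right].
have LI : L `|` I = I by apply/setUidPr => r Lr; apply: AI; left.
by split; rewrite LI.
Qed.

Lemma jacobson_mull (R : pzRingType) (a x : R) :
  jacobson_radical R x -> jacobson_radical R (a * x).
Proof.
move=> Jx M maxM; case: (maxM) => idM _ _.
by apply: left_ideal_mull => //; apply: Jx.
Qed.

(** A form of Nakayama's lemma: the left annihilator of [h] contains [1 - x],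
    so it lies in no maximal left ideal and must be the whole ring. *)
Lemma jacobson_fixed_eq0 (R : pzRingType) (x h : R) :
  jacobson_radical R x -> x * h = h -> h = 0.
Proof.
move=> Jx xh; apply: contrapT => h0.
have idAnn : @left_ideal R [set r : R | r * h = 0].
  apply/left_idealP; split=> [|a u v /= uh vh]; first exact: mul0r.
  by rewrite mulrDl -mulrA uh vh mulr0 addr0.
have [|M maxM AnnM] := exists_maximal_left_ideal idAnn.
  by rewrite /= mul1r.
have [idM MT _] := maxM; apply: MT; apply: left_ideal_eqT => //.
have M1x : M (1 - x) by apply: AnnM; rewrite /= mulrBl mul1r xh subrr.
have /left_idealP[_ MS] := idM.
by have := MS 1 _ _ (Jx M maxM) M1x; rewrite mul1r addrC subrK.
Qed.

Lemma expr_mul_eq1 (R : pzRingType) (a b : R) n :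
  a * b = 1 -> a ^+ n * b ^+ n = 1.
Proof.
move=> ab; elim: n => [|n IHn]; first by rewrite mulr1.
by rewrite exprSr exprS mulrA -(mulrA _ a) ab mulr1.
Qed.

Lemma expr_fixed (R : pzRingType) (x h : R) n : x * h = h -> x ^+ n * h = h.
Proof.
by move=> xh; elim: n => [|n IHn]; rewrite ?mul1r // exprSr -mulrA xh.
Qed.

Lemma mul_expr_eq (R : pzRingType) (f a j : R) n :
  f * j = j * f -> f * a = f * j -> f * a ^+ n = f * j ^+ n.
Proof.
move=> fj fa; elim: n => // n IHn.
have fjn : f * j ^+ n = j ^+ n * f by apply: commrX.
by rewrite exprSr mulrA IHn fjn -mulrA fa mulrA -fjn -mulrA -exprSr.
Qed.

(** An element with a right inverse has trivial idempotent part: on the summand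
    cut out by [1 - e] it would be both right invertible and nilpotent modulo
    the radical, since there [a] and [j] agree. *)
Lemma right_invertible_idempotent_eq1 (R : pzRingType) (a b e j : R) :
  a * b = 1 -> a = e + j -> e ^+ 2 = e -> jsharp R j -> e * j = j * e -> e = 1.
Proof.
move=> ab aE ee [n _ Jjn] ej; pose f := 1 - e.
have fe : f * e = 0 by rewrite mulrBl mul1r -expr2 ee subrr.
have ff : f * f = f by rewrite {2}/f mulrBr mulr1 fe subr0.
have fj : f * j = j * f by rewrite mulrBl mulrBr ej mul1r mulr1.
have fa : f * a = f * j by rewrite aE mulrDr fe add0r.
have abn := expr_mul_eq1 n ab.
have bf0 : b ^+ n * f = 0.
  apply: (jacobson_fixed_eq0 (jacobson_mull (b ^+ n * f) Jjn)).
  rewrite -(mulrA (b ^+ n) f) -(mul_expr_eq n fj fa) -!mulrA.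
  by rewrite (mulrA (a ^+ n)) abn mul1r ff.
have f0 : f = 0 by rewrite -[f]mul1r -abn -mulrA bf0 mulr0.
by apply/esym/eqP; rewrite -subr_eq0; apply/eqP.
Qed.

Theorem lemma2p14 (R : pzRingType) :
  strongly_jsharp_clean R -> dedekind_finite R.
Proof.
move=> clean a b ab; have [e [j [aE ee Jj ej]]] := clean a.
have e1 := right_invertible_idempotent_eq1 ab aE ee Jj ej.
have [n _ Jjn] := Jj.
have ah : a * (1 - b * a) = 0 by rewrite mulrBr mulr1 mulrA ab mul1r subrr.
have jh : - j * (1 - b * a) = 1 - b * a.
  have -> : - j = 1 - a by rewrite aE e1 opprD addrA subrr sub0r.
  by rewrite mulrBl mul1r ah subr0.
have Jn : jacobson_radical R ((- j) ^+ n).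
  by rewrite exprNn; apply: jacobson_mull.
have h0 := jacobson_fixed_eq0 Jn (expr_fixed n jh).
by apply/esym/eqP; rewrite -subr_eq0 h0.
Qed.
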